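(* Let $K$ be a compact metrizable space with finitely many accumulation points. Then the closed unit ball $B_{C(K)}$ of $C(K)$ is plastic, i.e. every non-expansive bijection $F:B_{C(K)}\to B_{C(K)}$ is an isometry.
   Context: $C(K)$ denotes the Banach space of real-valued continuous functions on $K$ with the supremum norm, and $B_{C(K)}$ its closed unit ball with the metric induced by the norm. A map $F$ between metric spaces is non-expansive if it is $1$-Lipschitz. A metric space $M$ is plastic if every non-expansive bijection $F:M\to M$ is an isometry. *)

(* Defs.v *)
From HB Require Import structures.
From mathcomp Require Import all_boot all_order all_algebra.
From mathcomp Require Import all_classical all_reals all_analysis.
Set Implicit Arguments. Unset Strict Implicit. Unset Printing Implicit Defensive.
Import Order.TTheory GRing.Theory Num.Theory.
Import numFieldNormedType.Exports.
Local Open Scope classical_set_scope.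
Local Open Scope ring_scope.

Record CKball (R : realType) (K : topologicalType) := MkCKball {
  ckfun :> K -> R;
  ckfun_cont : continuous ckfun;
  ckfun_le1 : forall x, `|ckfun x| <= 1 }.

Definition ckdist (R : realType) (K : topologicalType) (f g : CKball R K) : R :=
  sup [set `|f x - g x| | x in [set: K]].

Definition nonexpansive (R : realType) (K : topologicalType)
  (F : CKball R K -> CKball R K) : Prop :=
  forall f g, ckdist (F f) (F g) <= ckdist f g.

Definition isometry (R : realType) (K : topologicalType)
  (F : CKball R K -> CKball R K) : Prop :=
  forall f g, ckdist (F f) (F g) = ckdist f g.

Definition plastic_ball (R : realType) (K : topologicalType) : Prop :=
  forall F : CKball R K -> CKball R K,
    nonexpansive F -> bijective F -> isometry F.

(* Main.v *)
Require Import Defs.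
From HB Require Import structures.
From mathcomp Require Import all_boot all_order all_algebra.
From mathcomp Require Import all_classical all_reals all_analysis.
From mathcomp Require Import lra.
Import Order.TTheory GRing.Theory Num.Theory.
Import Num.Def numFieldNormedType.Exports.
Local Open Scope classical_set_scope.
Local Open Scope ring_scope.

(* Let F be a non-expansive bijection of the ball with inverse G, s the finite
   set of accumulation points and I the dense set of isolated points of K.

   F fixes 0, since F 0 is within distance 1 of both constants 1 and -1, and
   comparing midpoints shows that G preserves unimodular functions.  For k in I
   the images under F of the positive and negative multiples of the indicator of
   k must be supported at one common isolated point sigma k, and then
   G e k = (G 1) k * e (sigma k) for every unimodular e.  Compactness extends
   sigma to K, and finiteness of s makes it a homeomorphism.  Composing F with
   the isometry f |-> (G 1) * (f o sigma), we may assume that F fixes all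
   unimodular functions.

   Comparing with unimodular functions then shows that F f lies pointwise
   between 0 and f, so the orbits of G move monotonically in each coordinate.
   As G is expansive, an orbit that moves only finitely many coordinates of a
   nowhere vanishing f is constant.  Induction on the number of p in s with
   |f p| < 1 finishes the proof: with alpha the largest such |f p|, and f
   perturbed so that only finitely many values satisfy alpha <= |f x| < 1, the
   function (f / |f|) * min(1, |f| + 1 - alpha) is fixed by induction, and its
   distance to f prevents F from moving the values with |f x| <= alpha. *)

(** * Counting in lists, finite maxima, and inverses of continuous bijections *)

Lemma ltn_count (T : eqType) (a b : pred T) (l : seq T) (x : T) :
  subpred a b -> x \in l -> b x -> ~~ a x -> (count a l < count b l)%N.
Proof.
move=> ab; elim: l => //= y l ih; rewrite inE.
move=> /orP[/eqP<- bx /negPf ax|xl bx ax].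
  by rewrite bx ax add0n add1n ltnS; exact: sub_count.
rewrite -addnS leq_add ?ih //.
by case: (boolP (a y)) => // /ab ->.
Qed.

(** Supplies the level [alpha] of the perturbation argument; the value 0 stands for an empty
    maximum. *)
Lemma seq_max (R : realType) (T : eqType) (P : pred T) (G : T -> R)
    (l : seq T) : (forall x, 0 <= G x) ->
  exists m, (forall x, x \in l -> P x -> G x <= m) /\
    (m = 0 \/ exists2 x, x \in l /\ P x & m = G x).
Proof.
move=> G0; elim: l => [|y l [m [lm mE]]]; first by exists 0; split; [|left].
have m0 : 0 <= m by case: mE => [->//|[x _ ->]].
have [Py|nPy] := boolP (P y); last first.
  exists m; split.
    move=> x; rewrite inE => /orP[/eqP->|xl]; first by rewrite (negPf nPy).
    exact: lm.
  case: mE => [->|[x [xl Px] mx]]; first by left.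
  by right; exists x => //; rewrite inE xl orbT.
exists (Num.max (G y) m); split.
  move=> x; rewrite inE le_max => /orP[/eqP->|xl Px]; first by rewrite lexx.
  by rewrite lm // orbT.
right; case: mE => [->|[x [xl Px] mx]].
  by exists y; rewrite ?mem_head // max_l.
have [_|_] := leP m (G y); first by exists y; rewrite ?mem_head.
by exists x => //; rewrite inE xl orbT.
Qed.

Lemma uniq_map_inj_in (T1 T2 : eqType) (h : T1 -> T2) (l : seq T1) :
  uniq [seq h x | x <- l] -> {in l &, injective h}.
Proof.
elim: l => // z l ih /= /andP[zl ul] x y; rewrite !inE.
move=> /orP[/eqP->|xl] /orP[/eqP->|yl] // hxy; last exact: ih.
  by move: zl; rewrite hxy map_f.
by move: zl; rewrite -hxy map_f.
Qed.

Lemma continuous_inverse (T : topologicalType) (sigma tau : T -> T) :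
  hausdorff_space T -> compact [set: T] -> continuous sigma ->
  cancel sigma tau -> cancel tau sigma -> continuous tau.
Proof.
move=> hT cT csigma sigmaK tauK; apply/continuousP => A oA.
have -> : tau @^-1` A = ~` (sigma @` (~` A)).
  apply/seteqP; split => y /=.
    by move=> Ay [x nAx xy]; apply: nAx; rewrite -(sigmaK x) xy.
  by move=> nA; apply: contrapT => nAy; apply: nA; exists (tau y).
apply/closed_openC/(compact_closed hT)/continuous_compact.
  exact: continuous_subspaceT.
by apply: (subclosed_compact _ cT) => //; exact: open_closedC.
Qed.

(** * Elementary facts on the unit ball *)

Section UnitBall.
Set Implicit Arguments.
Unset Strict Implicit.
Variables (R : realType) (K : topologicalType).
Implicit Types (f g : CKball R K) (c : R).

Lemma ckball_ext f g : (forall x, f x = g x) -> f = g.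
Proof.
case: f g => [f fc f1] [g gc g1] /= /funext fg; subst g.
by congr MkCKball; exact: Prop_irrelevance.
Qed.

Lemma ckdist_ge f g x : `|f x - g x| <= ckdist f g.
Proof.
apply: ub_le_sup; last by exists x.
exists 2 => _ [y _ <-].
have := ckfun_le1 f y; have := ckfun_le1 g y; rewrite !ler_norml; lra.
Qed.

Lemma ckdist_le f g c : 0 <= c -> (forall x, `|f x - g x| <= c) ->
  ckdist f g <= c.
Proof.
move=> c0 fgc; rewrite /ckdist.
have [->|/set0P ne] := eqVneq [set `|f x - g x| | x in [set: K]] set0.
  by rewrite sup0.
by apply: ge_sup => // _ [x _ <-].
Qed.

(** A form without suprema: a bound checked pointwise is returned pointwise. *)
Definition pointwise_nonexpansive (F : CKball R K -> CKball R K) :=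
  forall c f g, (forall x, `|f x - g x| <= c) ->
  forall x, `|F f x - F g x| <= c.

Lemma nonexpansive_pointwise F :
  nonexpansive F -> pointwise_nonexpansive F.
Proof.
move=> neF c f g fgc x; apply: le_trans (ckdist_ge _ _ x) _.
apply: le_trans (neF f g) _; apply: ckdist_le => //.
by apply: le_trans (fgc x).
Qed.

(** These are the extreme points of the ball, that is, the sign functions of clopen sets. *)
Definition unimodular f := forall x, `|f x| = 1.

Lemma unimodularP f x : unimodular f -> f x = 1 \/ f x = -1.
Proof.
by move=> /(_ x)/eqP; rewrite eqr_norml ler01 andbT => /orP[]/eqP; [left|right].
Qed.

Lemma unimodular_near f x : unimodular f -> \forall y \near x, f y = f x.
Proof.
move=> uf; have /cvgrPdist_lt /(_ 1 ltr01) := @ckfun_cont _ _ f x.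
apply: filterS => y; case: (unimodularP x uf) => ->;
  case: (unimodularP y uf) => -> //; rewrite ?ltr_norml; lra.
Qed.

Lemma cst_ck_cont c : continuous (fun _ : K => c).
Proof. by move=> x; exact: cvg_cst. Qed.

Lemma one_ck_le1 (x : K) : `|1 : R| <= 1.
Proof. by rewrite normr1. Qed.

Lemma zero_ck_le1 (x : K) : `|0 : R| <= 1.
Proof. by rewrite normr0. Qed.

Definition one_ck := MkCKball (@cst_ck_cont 1) one_ck_le1.
Definition zero_ck := MkCKball (@cst_ck_cont 0) zero_ck_le1.

Lemma one_unimodular : unimodular one_ck.
Proof. by move=> x; rewrite /= normr1. Qed.

Lemma scale_ckball c f : `|c| <= 1 ->
  exists g : CKball R K, forall x, g x = c * f x.
Proof.
move=> c1; have gc : continuous (fun x => c * f x).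
  by move=> x; apply: cvgM; [exact: cvg_cst|exact: ckfun_cont].
have g1 x : `|c * f x| <= 1 by rewrite normrM mulr_ile1 ?ckfun_le1.
by exists (MkCKball gc g1).
Qed.

Lemma cst_unimodular c : `|c| = 1 ->
  exists e : CKball R K, unimodular e /\ forall x, e x = c.
Proof.
move=> c1; have c1' : `|c| <= 1 by rewrite c1.
have [e eE] := scale_ckball one_ck c1'.
by exists e; split => x; rewrite eE /= mulr1.
Qed.

Lemma mul_ckball f g : exists h : CKball R K, forall x, h x = f x * g x.
Proof.
have gc : continuous (fun x => f x * g x).
  by move=> x; apply: cvgM; exact: ckfun_cont.
have g1 x : `|f x * g x| <= 1 by rewrite normrM mulr_ile1 ?ckfun_le1.
by exists (MkCKball gc g1).
Qed.

End UnitBall.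

(** * Topology of a compact space with finitely many accumulation points *)

Section FiniteAccumulation.
Set Implicit Arguments.
Unset Strict Implicit.
Variables (R : realType) (K : pseudoMetricType R).
Hypotheses (K_hausdorff : hausdorff_space K) (K_compact : compact [set: K]).
Variable s : seq K.
Hypothesis sE : limit_point [set: K] = [set` s].

Lemma isolated_nbhs x : x \notin s -> nbhs x [set x].
Proof.
move=> xs; have : ~ limit_point [set: K] x by rewrite sE /=; exact/negP.
by rewrite not_limit_pointE => -[X xX]; rewrite setTI => /filterS; apply.
Qed.

Lemma continuous_acc (h : K -> R) :
  (forall p, p \in s -> {for p, continuous h}) -> continuous h.
Proof.
move=> hs x; have [/hs//|/isolated_nbhs xi] := boolP (x \in s).
move=> U /nbhs_singleton hU; rewrite /nbhs /=.
by apply: filterS xi => y ->.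
Qed.

Lemma nbhs_neq (x y : K) : x != y -> nbhs x [set z | z != y].
Proof.
move=> xy; apply: open_nbhs_nbhs; split => //.
rewrite (_ : [set z | z != y] = ~` [set y]); last first.
  by apply/seteqP; split => z /= /eqP.
exact/closed_openC/accessible_closed_set1/hausdorff_accessible.
Qed.

(** Near [p], every point other than [p] avoids the finite list [s ++ l]. *)
Lemma nbhs_isolated_avoid (l : seq K) p U : p \in s -> nbhs p U ->
  exists k, [/\ k \notin s, k \notin l & U k].
Proof.
move=> ps pU.
have acc : limit_point [set: K] p by rewrite sE.
have av (l' : seq K) : nbhs p [set z | z != p -> z \notin l'].
  elim: l' => [|q l' ih]; first by apply: filterS filterT.
  have [<-|pq] := eqVneq p q.
    by apply: filterS ih => z /= zl zp; rewrite inE negb_or zp zl.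
  apply: filterS2 (nbhs_neq pq) ih => z /= zq zl zp.
  by rewrite inE negb_or zq zl.
have [y [yp _ [Uy]]] := acc _ (filterI pU (av (s ++ l))).
by move/(_ yp); rewrite mem_cat negb_or => /andP[]; exists y.
Qed.

(** Otherwise the sets [B E] generate a proper filter. Its cluster point cannot lie in [s], because
    of [U], and cannot be isolated, since it may be put into [E]. *)
Lemma cofinite_nbhs_acc (U : set K) : (forall p, p \in s -> nbhs p U) ->
  exists E : seq K, forall x, x \notin E -> U x.
Proof.
move=> sU; apply: contrapT => noE.
pose B (E : seq K) := [set x | x \notin E /\ ~ U x].
have FF : ProperFilter (filter_from setT B).
  apply: filter_from_proper.
    apply: filter_from_filter; first by exists [::].
    move=> E1 E2 _ _; exists (E1 ++ E2) => // x; rewrite /B /= mem_cat negb_or.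
    by move=> [/andP[? ?] ?].
  move=> E _; apply: contrapT => BE; apply: noE; exists E => x xE.
  by apply: contrapT => Ux; apply: BE; exists x.
have [|y [_ yF]] := K_compact FF; first by exists [::].
have [ys|/isolated_nbhs yi] := boolP (y \in s).
  have [|z [[_ nUz] Uz]] := yF (B [::]) U _ (sU _ ys); first by exists [::].
  exact: nUz.
have [|z [[zy _] /= zE]] := yF (B [:: y]) [set y] _ yi; first by exists [:: y].
by move: zy; rewrite zE mem_head.
Qed.

Lemma ge0_isolated (h : K -> R) : continuous h ->
  (forall x, x \notin s -> 0 <= h x) -> forall x, 0 <= h x.
Proof.
move=> hc h0 x; have [xs|/h0//] := boolP (x \in s).
rewrite leNgt; apply/negP => hx.
have /cvgr_lt /(_ 0 hx) xU : h y @[y --> x] --> h x := hc x.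
have [k [ks _ /=]] := nbhs_isolated_avoid [::] xs xU.
by rewrite ltNge h0.
Qed.

(** Serves to define functions near each accumulation point [p] by reference to the value at [p],
    which makes them continuous there. Hausdorff separation provides the regions on which [r] is
    constant. *)
Lemma retraction_acc :
  exists r : K -> K, forall p, p \in s -> \forall k \near p, r k = p.
Proof.
elim: s => [|q l [r rl]]; first by exists id.
suff [A [qA lA]] : exists A : set K, nbhs q A /\
    forall p, p \in l -> p != q -> nbhs p (~` A).
  exists (fun k => if `[< A k >] then q else r k) => p; rewrite inE.
  have [-> _|pq /= pl] := eqVneq p q.
    by apply: filterS qA => k Ak; rewrite asboolT.
  apply: filterS2 (rl _ pl) (lA _ pl pq) => k rk Ak.
  by rewrite asboolF.
elim: l {r rl} => [|p l [A [qA lA]]].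
  by exists setT; split=> //; exact: filterT.
have [->|pq] := eqVneq p q.
  exists A; split => // x; rewrite inE => /orP[/eqP-> /negP|]; last exact: lA.
  by rewrite eqxx.
move: (K_hausdorff); rewrite open_hausdorff => /(_ p q pq).
move=> [[U V] /= [/set_mem Up /set_mem Vq] [oU oV /eqP UV]].
exists (A `&` V); split; first by apply: filterI => //; exact: open_nbhs_nbhs.
move=> x; rewrite inE => /orP[/eqP-> _|xl xq].
  have : nbhs p U by exact: open_nbhs_nbhs.
  by apply: filterS => z Uz [_ Vz]; have : (U `&` V) z by []; rewrite UV.
by apply: filterS (lA _ xl xq) => z Az [].
Qed.

(* A truncated distance to p, which is all the metrizability needed. *)
Lemma gauge_at (p : K) : exists eta : K -> R,
  [/\ forall k, 0 <= eta k <= 1, eta p = 0,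
      forall k, k != p -> 0 < eta k & {for p, continuous eta}].
Proof.
pose S k := [set r : R | 0 <= r <= 1 /\ (r = 0 \/ ~ ball p r k)].
have S0 k : S k 0 by split; [rewrite lexx ler01|left].
have hS k : has_sup (S k).
  by split; [exists 0|exists 1 => r [/andP[]]].
have e1 k : sup (S k) <= 1.
  by apply: ge_sup; [exists 0|move=> r [/andP[]]].
have e0 k : 0 <= sup (S k) by apply: sup_ubound => //; case: (hS k).
have small k e : 0 < e -> ball p e k -> sup (S k) <= e.
  move=> e_gt0 pek; apply: ge_sup; first by exists 0.
  move=> r [r01 [->|nb]]; first exact: ltW.
  by rewrite leNgt; apply/negP => er; apply: nb; apply: le_ball pek; exact: ltW.
exists (fun k => sup (S k)); split.
- by move=> k; rewrite e0 e1.
- apply/eqP; rewrite eq_le e0 andbT; apply/ler_addgt0Pr => e e_gt0.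
  by rewrite add0r; apply: small => //; exact: ballxx.
- move=> k kp.
  have [r r0 nr] : exists2 r, 0 < r & ~ ball p r k.
    have /nbhs_ballP [r /= r0 rk] : nbhs p [set z | z != k].
      by apply: nbhs_neq; rewrite eq_sym.
    by exists r => // /rk /=; rewrite eqxx.
  have m0 : 0 < minr r 1 by rewrite lt_min r0 ltr01.
  apply: lt_le_trans m0 _; apply: sup_ubound; first by case: (hS k).
  split; first by rewrite le_min ltW//= ler01 ge_min lexx orbT.
  by right=> mb; apply: nr; apply: le_ball mb; rewrite ge_min lexx.
- have ep : sup (S p) = 0.
    apply/eqP; rewrite eq_le e0 andbT; apply/ler_addgt0Pr => e e_gt0.
    by rewrite add0r; apply: small => //; exact: ballxx.
  apply/cvgrPdist_le => e e_gt0; near=> k.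
  rewrite ep sub0r normrN ger0_norm //; apply: small => //.
  by near: k; exact: nbhsx_ballx.
Unshelve. all: by end_near. Qed.

(** The clopen set is [V] cut down to the fibre of [r] over [y] if [y] is an accumulation point, and
    to [y] alone otherwise. *)
Lemma clopen_base (y : K) (V : set K) : nbhs y V ->
  exists e : CKball R K, [/\ unimodular e, e y = 1 & forall x, e x = 1 -> V x].
Proof.
move=> yV; have [r rP] := retraction_acc.
pose P k := V k /\ (k = y \/ y \in s /\ r k = y).
pose h k : R := if `[< P k >] then 1 else -1.
have h1 k : `|h k| = 1 by rewrite /h; case: ifP; rewrite ?normrN normr1.
have hc : continuous h.
  apply: continuous_acc => p ps.
  have [py|py] := eqVneq p y.
    apply: (near_cst_continuous (1 : R)); rewrite py in ps *.
    apply: filterS2 yV (rP _ ps) => k Vk rk; rewrite /h asboolT //.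
    by split=> //; right.
  apply: (near_cst_continuous (-1 : R)).
  apply: filterS2 (nbhs_neq py) (rP _ ps) => k /eqP ky rk.
  rewrite /h asboolF // => -[_ [//|[_]]]; rewrite rk => /eqP.
  by rewrite (negPf py).
have hl k : `|h k| <= 1 by rewrite h1.
exists (MkCKball hc hl); split => //=.
  by rewrite /h asboolT //; split; [exact: nbhs_singleton|left].
by move=> x; rewrite /h; case: asboolP => [[]//|_]; lra.
Qed.

Lemma unimodular_sep (x y : K) (a b : R) : x != y -> `|a| = 1 -> `|b| = 1 ->
  exists e : CKball R K, [/\ unimodular e, e x = a & e y = b].
Proof.
move=> xy a1 b1.
have [e [ue ex eV]] := clopen_base (nbhs_neq xy).
have ey : e y = -1.
  by case: (unimodularP y ue) => // /eV /=; rewrite eqxx.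
have a1' : `|a| <= 1 by rewrite a1.
have [->|ab] := eqVneq b a.
  by have [g [ug gE]] := cst_unimodular K a1; exists g.
have [g gE] := scale_ckball e a1'.
exists g; split; rewrite ?gE ?ex ?ey ?mulr1 //.
  by move=> z; rewrite gE normrM ue mulr1.
move: ab a1 b1; rewrite mulrN1 => ab /eqP + /eqP.
rewrite !eqr_norml ler01 !andbT => /orP[]/eqP a1 /orP[]/eqP b1;
  move: ab; rewrite a1 b1 ?eqxx ?opprK //.
Qed.

End FiniteAccumulation.

(** * Non-expansive maps that fix all unimodular functions *)

Section FixedUnimodular.
Set Implicit Arguments.
Unset Strict Implicit.
Variables (R : realType) (K : pseudoMetricType R).
Hypotheses (K_hausdorff : hausdorff_space K) (K_compact : compact [set: K]).
Variable s : seq K.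
Hypothesis sE : limit_point [set: K] = [set` s].
Variables H psi : CKball R K -> CKball R K.
Hypotheses (psiK : cancel psi H) (Hne : pointwise_nonexpansive H).
Hypothesis Hfix : forall e, unimodular e -> H e = e.
Implicit Types f g u : CKball R K.

(** By density an isolated point [j] suffices. There [H f] is compared with a unimodular function
    that opposes the sign of [H f j] at [j] and nearly follows the sign of [f] elsewhere. *)
Lemma between_0_id f x : 0 <= H f x * (f x - H f x).
Proof.
move: x; apply: (@ge0_isolated _ _ K_hausdorff _ sE
  (fun x => H f x * (f x - H f x))).
  move=> x; apply: cvgM; first exact: ckfun_cont.
  by apply: cvgB; exact: ckfun_cont.
move=> j js; set gj := H f j.
have [->|gj0] := eqVneq gj 0; first by rewrite mul0r.
have [sg [sg1 sgg]] : exists sg : R, (sg = 1 \/ sg = -1) /\ sg * gj = `|gj|.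
  have [g0|g0] := leP 0 gj.
    by exists 1; split; [left|rewrite mul1r ger0_norm].
  by exists (-1); split; [right|rewrite mulN1r ltr0_norm].
pose d := `|gj| / 2.
have d0 : 0 < d by rewrite divr_gt0 // normr_gt0.
have [r rP] := retraction_acc K_hausdorff s.
pose sgp (t : R) : R := if 0 <= t then 1 else -1.
(* The sign of [f] may jump near an accumulation point where [f] vanishes, so the sign at [r k] is
   used when [f k] is close to [f (r k)]. The cost is the error [d] in [ef]. *)
pose e k := if k == j then - sg else
  if `|f k - f (r k)| < d then sgp (f (r k)) else sgp (f k).
have ec : continuous e.
  apply: (continuous_acc sE) => p ps.
  have pj : p != j by apply: contraNneq js => <-.
  apply: (near_cst_continuous (sgp (f p))).
  have /cvgrPdist_lt /(_ d d0) fp := @ckfun_cont _ _ f p.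
  near=> k.
  have rk : r k = p by near: k; exact: rP.
  have kj : k != j by near: k; exact: (nbhs_neq K_hausdorff).
  rewrite /e (negPf kj) rk ifT // distrC.
  by near: k.
have e1 k : e k = 1 \/ e k = -1.
  rewrite /e; case: ifP => _.
    by case: sg1 => ->; rewrite ?opprK; [right|left].
  by case: ifP => _; rewrite /sgp; case: ifP; [left|right|left|right].
have ue k : `|e k| = 1 by case: (e1 k) => ->; rewrite ?normrN normr1.
have el k : `|e k| <= 1 by rewrite ue.
have sgpE t : sgp t * t = `|t|.
  rewrite /sgp; have [t0|t0] := leP 0 t.
    by rewrite mul1r ger0_norm.
  by rewrite mulN1r ltr0_norm.
have ef k : k != j -> - d <= e k * f k.
  move=> kj; rewrite /e (negPf kj); case: ifPn => [fd|_]; last first.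
    by rewrite sgpE; apply: le_trans (normr_ge0 _); rewrite oppr_le0 ltW.
  have := sgpE (f (r k)); have := normr_ge0 (f (r k)); move: fd.
  rewrite /sgp ltr_norml; case: ifP => _ /andP[]; lra.
(* The left side at [j] will be 1 plus the modulus of [gj]. As [d] is only half that modulus, the
   maximum must be [sg * f j]. *)
have := Hne (f := f) (g := MkCKball ec el) (c := 1 + Num.max d (sg * f j)).
rewrite (Hfix (e := MkCKball ec el) ue) => /(_ _ j) /=.
rewrite -/gj {2}/e eqxx => hc.
have {hc} : `|gj - - sg| <= 1 + Num.max d (sg * f j).
  apply: hc => k; have := ckfun_le1 f k; rewrite ler_norml => /andP[fk1 fk2].
  have [->|kj] := eqVneq k j.
    have : sg * f j <= Num.max d (sg * f j) by rewrite le_max lexx orbT.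
    move: (Num.max _ _) => m; have := ckfun_le1 f j.
    rewrite /e eqxx !ler_norml => /andP[].
    by case: sg1 => ->; lra.
  have := ef _ kj; have : d <= Num.max d (sg * f j) by rewrite le_max lexx.
  move: (Num.max _ _) => m; rewrite ler_norml.
  by case: (e1 k) => ->; lra.
have dg : `|gj| = 2 * d by rewrite /d mulrC divfK.
have gjl := ckfun_le1 (H f) j; rewrite -/gj ler_norml in gjl.
have : `|gj - - sg| = 1 + sg * gj.
  case: sg1 gjl {sgg} => -> /andP[? ?]; rewrite ?opprK.
    by rewrite ger0_norm; lra.
  by rewrite ler0_norm; lra.
move=> ->; rewrite lerD2l le_max sgg => /orP[|]; first by rewrite dg; lra.
move: gj0; rewrite -sgg -normr_gt0 -sgg.
by case: sg1 => ->; rewrite ?mul1r ?mulN1r; nra.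
Unshelve. all: by end_near. Qed.

Lemma psi_ge f x : 0 <= f x * (psi f x - f x).
Proof. by have := between_0_id (psi f) x; rewrite psiK. Qed.

Lemma psi_incr f x : f x != 0 ->
  `|f x| <= `|psi f x| /\ `|psi f x - f x| = `|psi f x| - `|f x|.
Proof.
have := psi_ge f x; move: (psi f x) (f x) => a b ab b0.
have [b_gt0|b_lt0|b_eq0] := ltgtP 0 b; last by rewrite -b_eq0 eqxx in b0.
  have ba : b <= a by rewrite -subr_ge0 -(pmulr_rge0 _ b_gt0).
  by rewrite !ger0_norm ?subr_ge0 ?(le_trans (ltW b_gt0)).
have ba : a <= b by rewrite -subr_le0 -(nmulr_rge0 _ b_lt0).
have a0 : a <= 0 by rewrite (le_trans ba)// ltW.
by rewrite !ler0_norm ?subr_le0 ?(ltW b_lt0)//; split; lra.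
Qed.

Lemma iter_psi_ge n f x : f x != 0 -> `|f x| <= `|iter n psi f x|.
Proof.
move=> fx; elim: n => //= n ih; apply: (le_trans ih).
by apply: (psi_incr _).1; rewrite -normr_gt0 (lt_le_trans _ ih) ?normr_gt0.
Qed.

Lemma iter_psi_neq0 n f x : f x != 0 -> iter n psi f x != 0.
Proof.
by move=> fx; rewrite -normr_gt0 (lt_le_trans _ (iter_psi_ge n fx)) ?normr_gt0.
Qed.

Lemma iter_psi_expansive n c f :
  (forall x, `|iter n.+1 psi f x - iter n psi f x| <= c) ->
  forall x, `|psi f x - f x| <= c.
Proof.
elim: n => //= n ih le_c; apply: ih => x.
by have := Hne le_c x; rewrite !psiK.
Qed.

(* The steps of the orbit of f under psi never get shorter, yet each coordinate
   moves monotonically in a bounded interval. *)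
Lemma fixed_of_finite_motion f (E : seq K) : (forall x, f x != 0) ->
  (forall n x, x \notin E -> iter n psi f x = f x) -> H f = f.
Proof.
move=> f0 fE; suff pf : psi f = f by rewrite -{1}pf psiK.
apply: ckball_ext => x0; apply/eqP; rewrite -subr_eq0 -normr_eq0.
rewrite eq_le normr_ge0 andbT leNgt; apply/negP => d0.
(* Halving makes some coordinate move by strictly more than [d] at every step, whether or not a
   supremum is attained. Hence [S], which is bounded, grows by at least [d] each time. *)
pose d := `|psi f x0 - f x0| / 2; have d_gt0 : 0 < d by rewrite divr_gt0.
pose S n := \sum_(x <- E) `|iter n psi f x|.
have S_le n : S n <= (size E)%:R.
  rewrite -sum1_size natr_sum; apply: ler_sum => x _; exact: ckfun_le1.
have S_step n : d <= S n.+1 - S n.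
  have [x xd] : exists x, d < `|iter n.+1 psi f x - iter n psi f x|.
    apply: contrapT => /forallNP nx.
    have /(_ x0) : forall x, `|psi f x - f x| <= d.
      by apply: (@iter_psi_expansive n) => x; rewrite leNgt; exact/negP/nx.
    by rewrite /d; lra.
  have xE : x \in E.
    by apply: contraTT xd => xE; rewrite !fE // subrr normr0 -leNgt ltW.
  have step y := psi_incr (iter_psi_neq0 n (f0 y)).
  rewrite /S -sumrB (big_rem _ xE) /= -(step x).2 -[d]addr0.
  apply: lerD; first exact: ltW.
  by apply: sumr_ge0 => y _; rewrite subr_ge0; exact: (step y).1.
have S_ge n : d *+ n <= S n.
  elim: n => [|n ih]; first by rewrite mulr0n /S; apply: sumr_ge0.
  by rewrite mulrS; have := S_step n; lra.
pose N := (Num.truncn ((size E)%:R / d)).+1.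
have : (size E)%:R < N%:R * d by rewrite -ltr_pdivrMr // truncnS_gt.
by rewrite ltNge mulr_natl (le_trans (S_ge N)).
Qed.

(** Take [a] with the sign of [u] and the given modulus. It is fixed and lies within [1 - alpha] of
    [u], so the modulus of [H u] is at least that of [a] minus [1 - alpha]. *)
Lemma norm_H_ge (alpha : R) u : 0 <= alpha <= 1 -> (forall x, u x != 0) ->
  (forall a : CKball R K,
    (forall x, `|a x| = Num.min 1 (`|u x| + 1 - alpha)) -> H a = a) ->
  forall x, Num.min alpha `|u x| <= `|H u x|.
Proof.
move=> /andP[a0 a1] u0 Ha.
pose m x := Num.min 1 (`|u x| + 1 - alpha).
have m0 x : 0 <= m x <= 1.
  rewrite /m le_min ge_min lexx ler01 /= andbT.
  by have := normr_ge0 (u x); lra.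
pose a x := u x / `|u x| * m x.
have n1 x : `|u x / `|u x| | = 1 by rewrite normf_div normr_id divff // normr_eq0.
have am x : `|a x| = m x.
  by rewrite /a normrM n1 mul1r ger0_norm //; case/andP: (m0 x).
have ac : continuous a.
  move=> x; apply: cvgM; last first.
    apply: (@continuous_min _ _ (fun=> 1) (fun x => `|u x| + 1 - alpha)).
      exact: cvg_cst.
    apply: cvgB; last exact: cvg_cst.
    apply: cvgD; last exact: cvg_cst.
    by apply: cvg_norm; exact: ckfun_cont.
  apply: cvgM; first exact: ckfun_cont.
  apply: cvgV; first by rewrite normr_eq0.
  by apply: cvg_norm; exact: ckfun_cont.
have al x : `|a x| <= 1 by rewrite am; case/andP: (m0 x).
have au x : `|MkCKball ac al x - u x| <= 1 - alpha.
  rewrite /= /a -{3}(divfK (_ : `|u x| != 0) (u x)) ?normr_eq0 //.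
  rewrite -mulrBr normrM n1 mul1r /m ler_norml minEle.
  have := ckfun_le1 u x; have := normr_ge0 (u x).
  case: ifP => [|/negbT]; rewrite -?ltNge; lra.
move=> x; have := Hne au x; rewrite (Ha (MkCKball ac al)) //=.
move=> /(le_trans (lerB_dist _ _)); rewrite am /m => h.
apply: le_trans (_ : Num.min 1 (`|u x| + 1 - alpha) - (1 - alpha) <= _); last lra.
rewrite lerBrDr !minEle; case: ifP => [|/negbT]; case: ifP => [|/negbT];
  rewrite -?ltNge; lra.
Qed.

(** Zeros are replaced by a small [d]. Near [p] in [s] the function becomes constant if its modulus
    at [p] is 1, and otherwise strictly smaller in modulus than at [p]; only finitely many points
    are not near [s]. *)
Lemma generic_approximation f (eps : R) : 0 < eps ->
  exists (g : CKball R K) (alpha : R) (E : seq K),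
  [/\ forall x, `|f x - g x| <= eps, forall x, g x != 0,
      forall p, p \in s -> (`|g p| < 1) = (`|f p| < 1),
      forall x, x \notin E -> `|g x| < alpha \/ `|g x| = 1 &
      alpha = 0 \/ exists2 p, p \in s & alpha <= `|g p| < 1].
Proof.
(* Three errors of size [d] add up: [f k] to [f (r k)], removal of a zero, and the factor [1 - eta].
   The bound by one half keeps a replaced zero below modulus 1. *)
move=> eps0; pose d := Num.min (eps / 3) 2^-1.
have d0 : 0 < d by rewrite lt_min divr_gt0 //= invr_gt0.
have d2 : d <= 2^-1 by rewrite ge_min lexx orbT.
have d3 : 3 * d <= eps by rewrite mulrC -ler_pdivlMr // ge_min lexx.
move: (d) d0 d2 d3 => {}d d0 d2 d3.
pose nz (t : R) := if t == 0 then d else t.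
have nz0 t : nz t != 0 by rewrite /nz; case: ifPn => // _; rewrite gt_eqF.
have nzd t : `|t - nz t| <= d.
  rewrite /nz; have [->|_] := eqVneq t 0; last by rewrite subrr normr0 ltW.
  by rewrite sub0r normrN gtr0_norm.
have nz1 t : (`|nz t| < 1) = (`|t| < 1).
  rewrite /nz; have [->|//] := eqVneq t 0.
  by rewrite normr0 ltr01 gtr0_norm //; lra.
have nzl t : `|t| <= 1 -> `|nz t| <= 1.
  by rewrite /nz; case: eqP => // _ _; rewrite gtr0_norm //; lra.
have [r rP] := retraction_acc K_hausdorff s.
have /choice [eta etaP] := gauge_at K_hausdorff.
pose V k := [/\ r k \in s, `|f k - f (r k)| <= d & eta (r k) k <= d].
pose cc p k := if `|nz (f p)| < 1 then nz (f p) * (1 - eta p k) else nz (f p).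
pose g k := if `[< V k >] then cc (r k) k else nz (f k).
have nearV p : p \in s -> \forall k \near p, r k = p /\ V k.
  move=> ps; have [_ etap _ /cvgrPdist_lt /(_ d d0) etac] := etaP p.
  have /cvgrPdist_lt /(_ d d0) fp := @ckfun_cont _ _ f p.
  near=> k.
  have rk : r k = p by near: k; exact: rP.
  split=> //; split; rewrite rk //.
    by rewrite distrC; apply: ltW; near: k.
  have : `|eta p p - eta p k| < d by near: k.
  by rewrite etap sub0r normrN => /ltW; apply: le_trans; exact: ler_norm.
have fin k := ckfun_le1 f k.
have ccE k : V k -> [/\ `|cc (r k) k| <= `|nz (f (r k))|, cc (r k) k != 0,
    `|f k - cc (r k) k| <= eps &
    k != r k -> `|nz (f (r k))| < 1 -> `|cc (r k) k| < `|nz (f (r k))|].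
  move=> [rs fd ed]; have [/(_ k) /andP[e0 e1] _ epos _] := etaP (r k).
  have := nzl _ (fin (r k)); have := nzd (f (r k)); have := nz0 (f (r k)).
  rewrite /cc; move: (nz (f (r k))) => c c0 cd c1.
  have c0' : 0 < `|c| by rewrite normr_gt0.
  case: ifP => [clt1|/negP cge]; last first.
    split => //; apply: le_trans (ler_distD (f (r k)) _ _) _; lra.
  have e1' : 0 < 1 - eta (r k) k by lra.
  split.
  - by rewrite normrM (gtr0_norm e1'); nra.
  - by rewrite mulf_neq0 // gt_eqF.
  - rewrite mulrBr mulr1 opprB addrA addrAC.
    apply: le_trans (ler_normD _ _) _.
    rewrite normrM (ger0_norm e0).
    have : `|f k - c| <= 2 * d.
      by apply: le_trans (ler_distD (f (r k)) _ _) _; lra.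
    by nra.
  - by move=> /epos ?; rewrite normrM (gtr0_norm e1'); nra.
have gl k : `|g k| <= 1.
  rewrite /g; case: asboolP => [/ccE[h _ _ _]|_]; last exact: nzl.
  by apply: le_trans h _; exact: nzl.
have g0 k : g k != 0.
  by rewrite /g; case: asboolP => [/ccE[]//|_]; exact: nz0.
have fg k : `|f k - g k| <= eps.
  rewrite /g; case: asboolP => [/ccE[]//|_].
  by apply: le_trans (nzd _) _; lra.
have gp p : p \in s -> g p = nz (f p).
  move=> ps; have [rp Vp] := nbhs_singleton (nearV _ ps).
  rewrite /g asboolT // rp /cc; case: ifP => // _.
  by have [_ -> _ _] := etaP p; rewrite subr0 mulr1.
have gc : continuous g.
  apply: (continuous_acc sE) => p ps.
  have ccc : cc p k @[k --> p] --> cc p p.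
    rewrite /cc; case: ifP => _; last exact: cvg_cst.
    apply: cvgM; first exact: cvg_cst.
    apply: cvgB; first exact: cvg_cst.
    by have [_ _ _] := etaP p.
  have -> : {for p, continuous g} = (g k @[k --> p] --> g p) by [].
  have [rp Vp] := nbhs_singleton (nearV _ ps).
  rewrite {2}/g asboolT // rp; apply: cvg_trans ccc.
  apply: near_eq_cvg; apply: filterS (nearV _ ps) => k [rk Vk].
  by rewrite /g asboolT // rk.
have [E0 E0P] : exists E : seq K, forall x, x \notin E -> V x.
  apply: (cofinite_nbhs_acc K_compact sE) => p /nearV.
  by apply: filterS => k [].
have [alpha [alpha_ge alphaE]] :=
  @seq_max R K (fun p => `|nz (f p)| < 1) (fun p => `|nz (f p)|) s
    (fun p => normr_ge0 _).
exists (MkCKball gc gl), alpha, (s ++ E0); split => //=.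
- by move=> p ps; rewrite gp // nz1.
- move=> x; rewrite mem_cat negb_or => /andP[xs /E0P Vx].
  have [_ _ _ cclt] := ccE _ Vx; have [rs _ _] := Vx.
  have xr : x != r x by apply: contraNneq xs => ->.
  rewrite /g asboolT //; have [lt1|ge1] := boolP (`|nz (f (r x))| < 1).
    by left; apply: lt_le_trans (cclt xr lt1) _; exact: alpha_ge.
  right; rewrite /cc (negPf ge1); apply/eqP; rewrite eq_le nzl //.
  by rewrite leNgt ge1.
- case: alphaE => [->|[p [ps plt] ->]]; first by left.
  by right; exists p => //; rewrite gp // lexx.
Unshelve. all: by end_near. Qed.

Theorem fixes_unimodular_id f : H f = f.
Proof.
suff fixn n : forall f, (count (fun p => (`|f p| < 1)%R) s < n)%N -> H f = f.
  exact: (fixn (count (fun p => `|f p| < 1) s).+1).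
elim: n => // n ih {}f; rewrite ltnS => fn.
apply: ckball_ext => x0; apply/eqP; rewrite -subr_eq0 -normr_eq0.
rewrite eq_le normr_ge0 andbT; apply/ler_addgt0Pr => eps' eps'0.
pose eps := eps' / 2; have eps0 : 0 < eps by rewrite divr_gt0.
have [g [alpha [E [fg g0 gs gE alphaE]]]] := generic_approximation f eps0.
suff gfix : H g = g.
  have h1 := Hne fg x0; rewrite gfix in h1.
  have h2 := fg x0; rewrite distrC in h2.
  rewrite add0r; apply: le_trans (ler_distD (g x0) _ _) _; rewrite /eps in h1 h2.
  lra.
(* It remains to see that the orbit of [g] is constant in each coordinate outside [E]. *)
apply: (@fixed_of_finite_motion g E) => // m x xE.
elim: m => // m ihm; set u := iter m.+1 psi g.
have Hu : H u = iter m psi g by rewrite /u /= psiK.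
have [le_gu dist_gu] : `|g x| <= `|u x| /\ `|u x - g x| = `|u x| - `|g x|.
  by rewrite -ihm; apply: psi_incr; exact: iter_psi_neq0.
suff ug : `|u x| <= `|g x|.
  by apply/eqP; rewrite -subr_eq0 -normr_eq0 dist_gu subr_eq0 eq_le ug.
case: (gE x xE) => [gx|->]; last exact: ckfun_le1.
case: alphaE => [alpha0|[p ps /andP[alphap p1]]].
  by move: gx; rewrite alpha0 ltNge normr_ge0.
(* Since [H u] is the previous iterate, its modulus at [x] is that of [g x], below [alpha]; the
   minimum is then the modulus of [u x]. *)
have : Num.min alpha `|u x| <= `|H u x|.
  apply: norm_H_ge; first by have := normr_ge0 (g x); lra.
    by move=> y; exact: iter_psi_neq0.
  (* A point where [a] has modulus below 1 has the same property for [g], but [p] is lost: there [u]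
     has modulus at least [alpha], so [a] has modulus 1. *)
  move=> a aE; apply: ih; apply: leq_trans fn.
  rewrite -(eq_in_count gs); apply: (ltn_count _ _ _ _ _ _ ps p1).
    move=> q; rewrite aE gt_min ltxx /= => uq.
    by apply: le_lt_trans (iter_psi_ge m.+1 (g0 q)) _; rewrite -/u; lra.
  rewrite -leNgt aE le_min lexx /=.
  by have := iter_psi_ge m.+1 (g0 p); rewrite -/u; lra.
by rewrite Hu ihm ge_min leNgt gx /=.
Qed.

End FixedUnimodular.

(** * Action of the inverse on unimodular functions *)

Section UnimodularImages.
Set Implicit Arguments.
Unset Strict Implicit.
Variables (R : realType) (K : pseudoMetricType R).
Hypotheses (K_hausdorff : hausdorff_space K) (K_compact : compact [set: K]).
Variable s : seq K.
Hypothesis sE : limit_point [set: K] = [set` s].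
Variables F G : CKball R K -> CKball R K.
Hypotheses (FK : cancel F G) (GK : cancel G F).
Hypothesis Fne : pointwise_nonexpansive F.
Implicit Types e f g w : CKball R K.

Let one := one_ck R K.
Let zero := zero_ck R K.

Lemma F_zero : F zero = zero.
Proof.
apply: ckball_ext => x /=.
have [e [_ eE]] : exists e, unimodular e /\ forall x, e x = 1.
  by apply: cst_unimodular; rewrite normr1.
have [e' [_ e'E]] : exists e, unimodular e /\ forall x, e x = -1.
  by apply: cst_unimodular; rewrite normrN normr1.
have h g y : `|g y - F zero y| <= 1.
  rewrite -{1}(GK g); apply: Fne => z; rewrite /= subr0; exact: ckfun_le1.
have := h e x; have := h e' x; rewrite eE e'E !ler_norml; lra.
Qed.

(** [F w] is within one half of both 0 and [e x], which are at distance 1. *)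
Lemma F_midpoint e w : unimodular e -> (forall x, `|w x| <= 2^-1) ->
  (forall x, `|G e x - w x| <= 2^-1) -> forall x, F w x = e x / 2.
Proof.
move=> ue w2 ew x.
have h1 : `|F w x| <= 2^-1.
  have := @Fne 2^-1 w zero _ x; rewrite F_zero /= subr0; apply => y.
  by rewrite subr0.
have := Fne ew x; rewrite GK; move: h1; rewrite !ler_norml.
by case: (unimodularP x ue) => ->; lra.
Qed.

(* The midpoint of 0 and G e is unique because F is injective, which forces
   |G e| = 1 everywhere. *)
Lemma G_unimodular e : unimodular e -> unimodular (G e).
Proof.
move=> ue; set u := G e.
(* Another midpoint of 0 and [u], which differs from [u / 2] wherever the modulus of [u] is below
   1. *)
pose v x := u x / 2 + (1 - `|u x|) / 2.
have u1 x : `|u x| <= 1 := ckfun_le1 u x.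
have v2 x : `|v x| <= 2^-1 /\ `|u x - v x| <= 2^-1.
  rewrite /v !ler_norml; have := u1 x; rewrite ler_norml.
  have [u0|u0] := leP 0 (u x); first by rewrite (ger0_norm u0); lra.
  by rewrite (ltr0_norm u0); lra.
have vc : continuous v.
  move=> x; apply: cvgD; apply: cvgM; try exact: cvg_cst.
    exact: ckfun_cont.
  by apply: cvgB; [exact: cvg_cst|apply: cvg_norm; exact: ckfun_cont].
have vl x : `|v x| <= 1 by apply: le_trans (v2 x).1 _; rewrite invf_le1 // ler1n.
have half1 : `|2^-1 : R| <= 1 by rewrite ger0_norm ?invr_ge0 // invf_le1 // ler1n.
have [w wE] := scale_ckball u half1.
have Fv := F_midpoint (w := MkCKball vc vl) ue
  (fun x => (v2 x).1) (fun x => (v2 x).2).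
have Fw : forall x, F w x = e x / 2.
  apply: F_midpoint => // x; rewrite wE -/u.
    by rewrite normrM ger0_norm ?invr_ge0 // ler_piMr ?invr_ge0.
  have -> : u x - 2^-1 * u x = 2^-1 * u x by lra.
  by rewrite normrM ger0_norm ?invr_ge0 // ler_piMr ?invr_ge0.
have vw : MkCKball vc vl = w.
  by apply: (can_inj FK); apply: ckball_ext => x; rewrite Fv Fw.
by move=> x; have := congr1 (fun g : CKball R K => g x) vw; rewrite /= wE /v; lra.
Qed.

(** Lets [bump] be defined for every real [t], as needed for a path to which the intermediate value
    theorem applies. *)
Definition clamp (t : R) := Num.max (-1) (Num.min 1 t).

Lemma clamp_le1 t : `|clamp t| <= 1.
Proof.
by rewrite ler_norml /clamp le_max lexx /= ge_max ge_min lexx /= andbT; lra.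
Qed.

Lemma clamp_id t : `|t| <= 1 -> clamp t = t.
Proof.
by rewrite ler_norml /clamp => /andP[? ?]; rewrite min_r // max_r.
Qed.

Lemma clamp_lip t t' : `|clamp t - clamp t'| <= `|t - t'|.
Proof.
wlog tt : t t' / t' <= t.
  by move=> h; have [/h//|/ltW/h] := leP t' t; rewrite distrC [leRHS]distrC.
rewrite [leRHS]ger0_norm ?subr_ge0 // ler_norml /clamp !maxEle !minEle.
by do !case: ifPn; rewrite -?ltNge; lra.
Qed.

Lemma bump_cont k (t : R) : k \notin s ->
  continuous (fun x : K => if x == k then clamp t else 0).
Proof.
move=> ks; apply: (continuous_acc sE) => p ps.
have pk : p != k by apply: contraNneq ks => <-.
apply: (near_cst_continuous (0 : R)).
by apply: filterS (nbhs_neq K_hausdorff pk) => x /negPf ->.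
Qed.

Lemma bump_le1 k (t : R) (x : K) : `|if x == k then clamp t else 0| <= 1.
Proof. by case: ifP => _; rewrite ?clamp_le1 ?normr0 ?ler01. Qed.

Definition bump k (ks : k \notin s) (t : R) :=
  MkCKball (bump_cont (t := t) ks) (bump_le1 k t).

Lemma bump0 k (ks : k \notin s) : bump ks 0 = zero.
Proof.
by apply: ckball_ext => x /=; rewrite clamp_id ?normr0 // if_same.
Qed.

Lemma F_bump_lip k (ks : k \notin s) t t' x :
  `|F (bump ks t) x - F (bump ks t') x| <= `|t - t'|.
Proof.
apply: Fne => y /=; case: ifP => _; first exact: clamp_lip.
by rewrite subr0 normr0.
Qed.

Lemma F_bump_neq0 k (ks : k \notin s) t : t != 0 -> `|t| <= 1 ->
  exists x, F (bump ks t) x != 0.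
Proof.
move=> t0 t1; apply: contrapT => /forallNP nx.
have : F (bump ks t) = F zero.
  by apply: ckball_ext => x; rewrite F_zero; apply/eqP/negPn/negP/nx.
move=> /(can_inj FK) /(congr1 (fun g : CKball R K => g k)) /=.
by rewrite eqxx clamp_id // => /eqP; rewrite (negPf t0).
Qed.

(** With equal signs at [k], the bump is within 1 of [G e], so its image is within 1 of [e] and
    cannot oppose its sign. *)
Lemma F_bump_sign k (ks : k \notin s) t e : `|t| <= 1 -> unimodular e ->
  0 < G e k * t -> forall x, 0 <= e x * F (bump ks t) x.
Proof.
move=> t1 ue ekt x.
have uGe := G_unimodular ue.
have h : `|e x - F (bump ks t) x| <= 1.
  rewrite -{1}(GK e); apply: Fne => y /=; case: eqP => [->|_].
    rewrite clamp_id //; move: ekt t1; rewrite !ler_norml.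
    by case: (unimodularP k uGe) => ->; lra.
  by rewrite subr0 uGe.
move: h; rewrite ler_norml.
by case: (unimodularP x ue) => ->; lra.
Qed.

(** If [x] and [y] differed, some unimodular [e] would oppose both image values; whichever sign
    [G e k] has, one of the two bumps contradicts [F_bump_sign]. *)
Lemma F_bump_support k (ks : k \notin s) (t t' : R) x y :
  0 < t -> `|t| <= 1 -> t' < 0 -> `|t'| <= 1 ->
  F (bump ks t) x != 0 -> F (bump ks t') y != 0 -> x = y.
Proof.
move=> t0 t1 t'0 t'1 hx hy; apply/eqP/negPn/negP => xy.
pose sgn (a : R) : R := if 0 <= a then -1 else 1.
have sgn1 a : `|sgn a| = 1 by rewrite /sgn; case: ifP; rewrite ?normrN normr1.
have sgnP a : a != 0 -> sgn a * a < 0.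
  rewrite neq_lt /sgn; case: ifPn; rewrite -?ltNge => ? /orP[] ?; lra.
have [e [ue ex ey]] := unimodular_sep K_hausdorff sE xy
  (sgn1 (F (bump ks t) x)) (sgn1 (F (bump ks t') y)).
case: (unimodularP k (G_unimodular ue)) => ek.
  have := F_bump_sign ks t1 ue; rewrite ek mul1r => /(_ t0 x).
  by rewrite ex leNgt sgnP.
have := F_bump_sign ks t'1 ue; rewrite ek mulN1r oppr_gt0 => /(_ t'0 y).
by rewrite ey leNgt sgnP.
Qed.

Lemma isolated_image k (ks : k \notin s) : exists (j : K) (sg : R),
  [/\ j \notin s, `|sg| = 1, forall e, unimodular e -> G e k = sg * e j,
      forall t x, `|t| <= 1 -> x != j -> F (bump ks t) x = 0 &
      0 < F (bump ks sg) j].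
Proof.
have n1 : `|1 : R| <= 1 by rewrite normr1.
have nN1 : `|-1 : R| <= 1 by rewrite normrN normr1.
have lt1 : (-1 : R) < 0 by rewrite oppr_lt0.
have [j hj] := F_bump_neq0 ks (oner_neq0 R) n1.
have [j' hj'] : exists x, F (bump ks (-1)) x != 0.
  by apply: F_bump_neq0; rewrite // oppr_eq0 oner_eq0.
have jj' := F_bump_support ltr01 n1 lt1 nN1 hj hj'; subst j'.
have supp t x : `|t| <= 1 -> x != j -> F (bump ks t) x = 0.
  move=> t1 xj; apply/eqP; apply: contraNT xj => ht; apply/eqP.
  have [t0|t0|t0] := ltgtP t 0.
  - by symmetry; exact: F_bump_support ltr01 n1 t0 t1 hj ht.
  - exact: F_bump_support t0 t1 lt1 nN1 ht hj'.
  - by move: ht; rewrite t0 bump0 F_zero /= eqxx.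
(* The image of the bump stays nonzero near [j], so an accumulation point would bring further points
   into the support. *)
have js : j \notin s.
  apply/negP => js.
  have hn : \forall x \near j, F (bump ks 1) x != 0.
    have /cvgrPdist_lt /(_ `|F (bump ks 1) j|) :=
      @ckfun_cont _ _ (F (bump ks 1)) j.
    rewrite normr_gt0 => /(_ hj); apply: filterS => x.
    by apply: contraTneq => ->; rewrite subr0 ltxx.
  have [x [xs _ hx]] := nbhs_isolated_avoid K_hausdorff sE [::] js hn.
  have xj : x != j by apply: contraNneq xs => ->.
  by move: hx; rewrite /= supp ?eqxx.
have [sg [sg1 sgh]] : exists sg : R,
    (sg = 1 \/ sg = -1) /\ 0 < sg * F (bump ks 1) j.
  have [h|h] := leP 0 (F (bump ks 1) j).
    by exists 1; split; [left|rewrite mul1r lt_neqAle eq_sym hj].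
  by exists (-1); split; [right|rewrite mulN1r oppr_gt0].
have nsg : `|sg| = 1 by case: sg1 => ->; rewrite ?normrN normr1.
have Gp e : unimodular e -> G e k = 1 -> e j = sg.
  move=> ue ek; have := F_bump_sign ks n1 ue; rewrite ek mulr1 => /(_ ltr01 j).
  move: sgh; case: sg1 => ->; case: (unimodularP j ue) => -> //; lra.
(* The constant [- sg] must be sent by [G] to a function equal to -1 at [k], by [Gp]; this fixes the
   sign of the image of the negative bump. *)
have hsg : sg * F (bump ks (-1)) j < 0.
  have [e [ue ejE]] : exists e, unimodular e /\ forall x, e x = - sg.
    by apply: cst_unimodular; rewrite normrN.
  have ek : G e k = -1.
    case: (unimodularP k (G_unimodular ue)) => // /(Gp _ ue).
    by rewrite ejE; case: sg1 => ->; lra.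
  have := F_bump_sign ks nN1 ue; rewrite ek mulrNN mulr1 => /(_ ltr01 j).
  rewrite ejE mulNr oppr_ge0 le_eqVlt mulf_eq0 (negPf hj') orbF => /orP[|//].
  by rewrite -normr_eq0 nsg oner_eq0.
exists j, sg; split => //; last first.
  move: sgh hsg; case: sg1 => ->; first by rewrite mul1r.
  by rewrite !mulN1r oppr_lt0.
move=> e ue; case: (unimodularP k (G_unimodular ue)) => ek.
  by rewrite (Gp _ ue ek) ek; case: sg1 => ->; lra.
have := F_bump_sign ks nN1 ue; rewrite ek mulrNN mulr1 => /(_ ltr01 j).
by move: hsg; case: sg1 => ->; case: (unimodularP j ue) => ->; lra.
Qed.

(** The intermediate value theorem on the Lipschitz path from the zero bump to [bump ks sg]. *)
Lemma F_bump_onto k (ks : k \notin s) (sg : R) j : `|sg| = 1 ->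
  0 < F (bump ks sg) j -> forall c, 0 <= c <= F (bump ks sg) j ->
  exists2 t, `|t| <= 1 & F (bump ks t) j = c.
Proof.
move=> sg1 hj c c0.
pose phi t := F (bump ks (sg * t)) j.
have phi_lip t t' : `|phi t - phi t'| <= `|t - t'|.
  apply: le_trans (F_bump_lip _ _ _ _) _.
  by rewrite -mulrBr normrM sg1 mul1r.
have phic : continuous phi.
  move=> t; apply/cvgrPdist_le => e e0; near=> t'.
  apply: le_trans (phi_lip _ _) _; near: t'.
  by apply: cvgr_dist_le => //; exact: cvg_id.
have [||t] := @IVT R phi 0 1 c ler01.
- exact: continuous_subspaceT.
- rewrite /phi mulr0 mulr1 bump0 F_zero /= min_l ?max_r //; exact: ltW.
- rewrite in_itv /= => /andP[t0 t1] <-; exists (sg * t) => //.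
  by rewrite normrM sg1 mul1r ger0_norm.
Unshelve. all: by end_near. Qed.

(** Bumps at [k] and at [k'] would both reach the same small positive multiple of the indicator of
    [j], against injectivity of [F]. *)
Lemma isolated_image_inj k k' (ks : k \notin s) (ks' : k' \notin s) j :
  (forall e, unimodular e -> G e k = G one k * e j) ->
  (forall e, unimodular e -> G e k' = G one k' * e j) -> k = k'.
Proof.
move=> Gk Gk'; apply/eqP/negPn/negP => kk'.
have img l (ls : l \notin s) :
    (forall e, unimodular e -> G e l = G one l * e j) ->
  exists sg : R, [/\ `|sg| = 1,
    forall t x, `|t| <= 1 -> x != j -> F (bump ls t) x = 0 &
    0 < F (bump ls sg) j].
  move=> Gl; have [i [sg [_ sg1 Gi supp pos]]] := isolated_image ls.
  exists sg; suff <- : i = j by split.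
  apply/eqP/negPn/negP => ij.
  have [e [ue ei ej]] := unimodular_sep K_hausdorff sE ij
    (normr1 R) (etrans (normrN 1) (normr1 R)).
  have := Gl e ue; have := Gi e ue; have := Gi one (@one_unimodular R K).
  rewrite /= ei ej !mulr1 mulrN1 => -> -> sgN.
  by move: sg1; rewrite (_ : sg = 0) ?normr0; lra.
have [sg [sg1 supp pos]] := img _ ks Gk.
have [sg' [sg'1 supp' pos']] := img _ ks' Gk'.
pose c := Num.min (F (bump ks sg) j) (F (bump ks' sg') j).
have c0 : 0 < c by rewrite lt_min pos pos'.
have [|t t1 tc] := F_bump_onto sg1 pos (c := c).
  by rewrite ltW //= ge_min lexx.
have [|t' t'1 t'c] := F_bump_onto sg'1 pos' (c := c).
  by rewrite ltW //= ge_min lexx orbT.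
have : bump ks t = bump ks' t'.
  apply: (can_inj FK); apply: ckball_ext => x.
  by have [->|xj] := eqVneq x j; [rewrite tc t'c|rewrite supp ?supp'].
move=> /(congr1 (fun g : CKball R K => g k)) /=.
rewrite eqxx (negPf kk') clamp_id // => t0.
by move: c0; rewrite -tc t0 bump0 F_zero /= ltxx.
Qed.

(** For an accumulation point, [y] is a cluster point of the images of nearby isolated points. It is
    chosen before [e], and the formula passes to the limit since unimodular functions are locally
    constant. *)
Lemma image_point x : exists y, (x \notin s -> y \notin s) /\
  forall e, unimodular e -> G e x = G one x * e y.
Proof.
have iso k : k \notin s -> exists j, j \notin s /\
    forall e, unimodular e -> G e k = G one k * e j.
  move=> ks; have [j [sg [js _ Gj _ _]]] := isolated_image ks.
  exists j; split=> // e ue.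
  by rewrite (Gj one (@one_unimodular R K)) /= mulr1; exact: Gj.
have [xs|xs] := boolP (x \in s); last first.
  by have [j [js Gj]] := iso _ xs; exists j.
have /choice [sigma sigmaP] : forall k, exists j, k \notin s ->
    forall e, unimodular e -> G e k = G one k * e j.
  move=> k; have [ks|ks] := boolP (k \in s); first by exists k.
  by have [j [_ Gj]] := iso _ ks; exists j.
pose B U := [set sigma k | k in U `&` [set k | k \notin s]].
have FF : ProperFilter (filter_from (nbhs x) B).
  apply: filter_from_proper.
    apply: filter_from_filter; first by exists setT; exact: filterT.
    move=> U V xU xV; exists (U `&` V); first exact: filterI.
    by move=> _ [k [[Uk Vk] ks] <-]; split; exists k.
  move=> U xU.
  have [k [ks _ Uk]] := nbhs_isolated_avoid K_hausdorff sE [::] xs xU.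
  by exists (sigma k), k.
have [|y [_ yF]] := K_compact FF; first by exists setT; first exact: filterT.
exists y; split=> // e ue.
pose U := [set k | G e k = G e x /\ G one k = G one x].
have xU : nbhs x U.
  by apply: filterI; apply: unimodular_near; apply: G_unimodular => //;
    exact: (@one_unimodular R K).
have [|z [[k [[Gk G1k] ks] <-] ez]] := yF (B U) _ _ (unimodular_near y ue).
  by exists U.
by rewrite -Gk -G1k -ez; exact: sigmaP.
Qed.

Lemma unimodular_images : exists sigma tau : K -> K,
  [/\ cancel sigma tau, cancel tau sigma, continuous sigma, continuous tau &
      forall e x, unimodular e -> G e x = G one x * e (sigma x)].
Proof.
have /choice [sigma sigmaP] := image_point.
have Gs e x : unimodular e -> G e x = G one x * e (sigma x).
  by move=> ue; exact: (sigmaP x).2.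
have uG1 := G_unimodular (@one_unimodular R K).
have G1sq x : G one x * G one x = 1.
  by case: (unimodularP x uG1) => ->; rewrite ?mulrNN mulr1.
have eS e x : unimodular e -> e (sigma x) = G one x * G e x.
  by move=> ue; rewrite (Gs e) // mulrA G1sq mul1r.
(* Each [e] composed with [sigma] is locally constant by [eS], and such [e] describe a base of
   clopen sets. *)
have csigma : continuous sigma.
  move=> x V sxV; have [e [ue ex eV]] := clopen_base K_hausdorff sE sxV.
  suff : nbhs x [set y | V (sigma y)] by [].
  apply: filterS2 (unimodular_near x uG1) (unimodular_near x (G_unimodular ue)).
  move=> y G1y Gy; apply: eV.
  by rewrite eS // G1y Gy -eS.
have inj_iso k k' : k \notin s -> k' \notin s -> sigma k = sigma k' -> k = k'.
  move=> ks ks' kk'; apply: (@isolated_image_inj _ _ ks ks' (sigma k)).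
    by move=> e; exact: Gs.
  by move=> e; rewrite kk'; exact: Gs.
(* If [sigma p] were isolated, [sigma] would be constant near [p] and identify two isolated
   points. *)
have acc p : p \in s -> sigma p \in s.
  move=> ps; apply/negPn/negP => /(isolated_nbhs sE) /csigma pU.
  have [k [ks _ sk]] := nbhs_isolated_avoid K_hausdorff sE [::] ps pU.
  have [k' [ks' kk' sk']] := nbhs_isolated_avoid K_hausdorff sE [:: k] ps pU.
  move: kk'; rewrite inE => /eqP; apply; apply: inj_iso => //.
  by rewrite sk sk'.
(* If [j] were missed, the function equal to 1 only at [j] and the constant -1 would have the same
   image under [G]. *)
have surj_iso j : j \notin s -> exists x, sigma x = j.
  move=> js; apply: contrapT => /forallNP nj.
  have [e [ue ej eV]] := clopen_base K_hausdorff sE (isolated_nbhs sE js).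
  have [m [um mE]] : exists m : CKball R K, unimodular m /\ forall x, m x = -1.
    by apply: cst_unimodular; rewrite normrN normr1.
  suff : e = m by move=> em; move: ej; rewrite em mE; lra.
  apply: (can_inj GK); apply: ckball_ext => x.
  rewrite (Gs e) // (Gs m) // mE.
  by have [/eV /nj|->] := unimodularP (sigma x) ue.
(* The range is compact, hence closed, and contains the dense set of isolated points. *)
have surj y : exists x, sigma x = y.
  have : closed (range sigma).
    apply/(compact_closed K_hausdorff)/continuous_compact => //.
    exact: continuous_subspaceT.
  move=> /closure_id cl; suff : closure (range sigma) y.
    by rewrite -cl => -[x _ <-]; exists x.
  move=> U yU; have [ys|/surj_iso [x xy]] := boolP (y \in s).
    have [k [/surj_iso [x xk] _ Uk]] :=
      nbhs_isolated_avoid K_hausdorff sE [::] ys yU.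
    by exists k; split => //; exists x.
  by exists y; split; [exists x|exact: nbhs_singleton].
(* Every point of [s] has its preimages in [s], so [sigma] maps this finite set onto itself. *)
have inj_acc : {in undup s &, injective sigma}.
  apply: uniq_map_inj_in; apply: (@leq_size_uniq _ (undup s)).
  - exact: undup_uniq.
  - move=> y; rewrite mem_undup => ys; have [x xy] := surj y.
    apply/mapP; exists x => //; rewrite mem_undup.
    by apply/negPn/negP => xs; have := (sigmaP x).1 xs; rewrite xy ys.
  - by rewrite size_map.
have inj x y : sigma x = sigma y -> x = y.
  have [xs|xs] := boolP (x \in s); have [ys|ys] := boolP (y \in s) => xy.
  - by apply: inj_acc; rewrite ?mem_undup.
  - by have := (sigmaP y).1 ys; rewrite -xy acc.
  - by have := (sigmaP x).1 xs; rewrite xy acc.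
  - exact: inj_iso.
have /choice [tau tauK] := surj.
have sigmaK : cancel sigma tau by move=> x; apply: inj; rewrite tauK.
exists sigma, tau; split=> //.
exact: (continuous_inverse _ _ _ K_hausdorff K_compact csigma sigmaK tauK).
Qed.

End UnimodularImages.

(** * Reduction to a map fixing the unimodular functions *)

Theorem theorem1p1 (R : realType) (K : pseudoMetricType R)
  (K_hausdorff : hausdorff_space K)
  (K_compact : compact [set: K])
  (K_finacc : finite_set (limit_point [set: K])) :
  plastic_ball R K.
Proof.
move=> F /nonexpansive_pointwise Fne [G FK GK].
have [s sE] := (finite_seqP _).1 K_finacc.
have [sigma [tau [sigmaK tauK csigma ctau Gs]]] :=
  unimodular_images K_hausdorff K_compact sE FK GK Fne.
have uG1 := G_unimodular FK GK Fne (@one_unimodular R K).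
set E1 := G (one_ck R K) in Gs uG1.
have E1sq x : E1 x * E1 x = 1.
  by case: (unimodularP x uG1) => ->; rewrite ?mulrNN mulr1.
have comp_cont (h : CKball R K) (rho : K -> K) : continuous rho ->
    continuous (fun x => h (rho x)).
  by move=> crho x; apply: (continuous_comp (crho x)); exact: ckfun_cont.
have comp_le1 (h : CKball R K) (rho : K -> K) x : `|h (rho x)| <= 1.
  exact: ckfun_le1.
have /choice [T TE] : forall h : CKball R K, exists g : CKball R K,
    forall x, g x = E1 x * h (sigma x).
  move=> h.
  exact: (mul_ckball E1 (MkCKball (comp_cont h _ csigma) (comp_le1 h _))).
have /choice [T' T'E] : forall h : CKball R K, exists g : CKball R K,
    forall x, g x = E1 (tau x) * h (tau x).
  move=> h; have [g gE] := mul_ckball E1 h.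
  exists (MkCKball (comp_cont g _ ctau) (comp_le1 g _)) => x /=; exact: gE.
have TK : cancel T T'.
  by move=> h; apply: ckball_ext => x; rewrite T'E TE tauK mulrA E1sq mul1r.
have T'K : cancel T' T.
  by move=> h; apply: ckball_ext => x; rewrite TE T'E sigmaK mulrA E1sq mul1r.
have FT_ne : pointwise_nonexpansive (F \o T).
  move=> c f g fgc; apply: Fne => x.
  by rewrite !TE -mulrBr normrM uG1 mul1r.
(* On unimodular functions [T] agrees with [G]. *)
have FT_fix e : unimodular e -> (F \o T) e = e.
  move=> ue /=; rewrite -[RHS]GK; congr F; apply: ckball_ext => x.
  by rewrite TE Gs.
have psiK : cancel (T' \o G) (F \o T) by move=> h; rewrite /= T'K GK.
have FT_id := fixes_unimodular_id K_hausdorff K_compact sE psiK FT_ne FT_fix.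
(* Thus [F] is a sign change followed by a relabelling of the points, which preserves the set of
   pointwise differences. *)
have FE f : F f = T' f by rewrite -{1}(T'K f); exact: FT_id.
move=> f g; rewrite !FE /ckdist; congr sup; apply/seteqP; split => _ [x _ <-] /=.
  exists (tau x) => //.
  by rewrite !T'E -mulrBr normrM uG1 mul1r.
exists (sigma x) => //.
by rewrite !T'E -mulrBr normrM uG1 mul1r sigmaK.
Qed.
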